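(* Let $n\in\mathbb N$ and $a,\alpha\in\mathbb R$. The derivative of order $s=n$ (second definition) of $f(x)=ax^\alpha$, $x>0$, is the ordinary derivative of order $n$ of $f$.
   Context: Second definition. For $(s,\alpha)\in\mathbb Q\times\mathbb R\setminus\{(-1,-1)\}$ and $a\in\mathbb R$, a derivative of order $s$ of $ax^\alpha$ ($x>0$) is any function of the form $$\frac{d^s(ax^\alpha)}{dx^s}=a\frac{\Gamma(\alpha+1)}{\Gamma(\alpha-s+1)}x^{\alpha-s}+\sum_{k=-|[s]|}^{-1}c_k\frac{x^{k-s}}{\Gamma(k-[s]+1)},$$ where the $c_k$ are arbitrary real constants, $[s]$ is the entire part of $s$ (truncation toward zero, so $[s]=0$ if $|s|<1$), and an empty sum is $0$. Conventions: $1/\Gamma(z)=0$ for $z\in\{0,-1,-2,\dots\}$; $\Gamma(\alpha+1)/\Gamma(\alpha-s+1)$ means $\lim_{z\to\alpha}\Gamma(z+1)/\Gamma(z-s+1)$. *)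

(* Defs.v *)
From mathcomp Require Import all_boot all_order all_algebra.
From mathcomp Require Import all_classical all_reals all_analysis.

Set Implicit Arguments.
Unset Strict Implicit.
Unset Printing Implicit Defensive.

Import Order.TTheory GRing.Theory Num.Theory.
Import numFieldNormedType.Exports.

Local Open Scope classical_set_scope.
Local Open Scope ring_scope.

(* Euler's integral; only meaningful for 0 < x. *)
Definition euler_gamma (R : realType) (x : R) : R :=
  \int[lebesgue_measure]_(t in `]0, +oo[) (t `^ (x - 1) * expR (- t)).

(* A number of unit steps that brings x into ]0, +oo[. *)
Definition gamma_shift (R : realType) (x : R) : nat :=
  if 0 < x then 0%N else (Num.truncn (- x)).+1.

(* The Gamma function on the real line, by Euler's integral on ]0, +oo[ and
   Gamma(x) = Gamma(x + m) / (x (x + 1) ... (x + m - 1)) elsewhere.  At the poles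
   0, -1, -2, ... the product vanishes and the value is the meaningless 0. *)
Definition Gamma (R : realType) (x : R) : R :=
  let m := gamma_shift x in
  euler_gamma (x + m%:R) / \prod_(i < m) (x + i%:R).

Definition gamma_pole (R : realType) (x : R) : bool :=
  (x \is a Num.int) && (x <= 0).

(* 1 / Gamma, with the convention that it vanishes at the poles of Gamma. *)
Definition inv_Gamma (R : realType) (x : R) : R :=
  if gamma_pole x then 0 else (Gamma x)^-1.

Definition entire_part (s : rat) : int :=
  if 0 <= s then Num.floor s else Num.ceil s.

(* L is the value of Gamma(alpha + 1) / Gamma(alpha - s + 1), understood as the
   limit of Gamma(z + 1) / Gamma(z - s + 1) as z tends to alpha, z <> alpha. *)
Definition is_gamma_ratio (R : realType) (s : rat) (alpha L : R) : Prop :=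
  Gamma (z + 1) * inv_Gamma (z - ratr s + 1) @[z --> alpha^'] --> L.

(* The sum over k = -|[s]|, ..., -1; the index j below stands for -k. *)
Definition complementary_sum (R : realType) (s : rat) (c : int -> R) (x : R) : R :=
  \sum_(1 <= j < `|entire_part s|.+1)
    (let k : int := - j%:Z in
     c k * x `^ (k%:~R - ratr s) * inv_Gamma ((k - entire_part s + 1)%:~R : R)).

(* g is, on ]0, +oo[, a derivative of order s of x |-> a x^alpha.  There is no
   such g when the ratio of Gamma values above does not exist as a finite limit. *)
Definition is_rat_derivative (R : realType) (s : rat) (a alpha : R)
    (g : R -> R) : Prop :=
  ~ (s = -1 /\ alpha = -1) /\
  exists (L : R) (c : int -> R),
    is_gamma_ratio s alpha L /\
    forall x : R, 0 < x ->
      g x = a * L * x `^ (alpha - ratr s) + complementary_sum s c x.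

(* Main.v *)
Require Import Defs.
From mathcomp Require Import all_boot all_order all_algebra.
From mathcomp Require Import all_classical all_reals all_analysis.
From mathcomp Require Import measurable_realfun.
From mathcomp Require Import ring lra zify.
Import Order.TTheory GRing.Theory Num.Theory.
Import numFieldNormedType.Exports.
Local Open Scope classical_set_scope.
Local Open Scope ring_scope.

(** At an integer order n >= 0 the arbitrary part of a derivative of order n
    disappears: its k-th term, for -n <= k <= -1, carries the factor
    1 / Gamma(k - n + 1), and k - n + 1 <= 0 is a pole of Gamma
    ([complementary_sum_nat]).  What remains is the power rule, as soon as the
    limit of Gamma(z + 1) / Gamma(z - n + 1) at alpha is known to be the falling
    factorial alpha (alpha - 1) ... (alpha - n + 1) ([is_gamma_ratio_nat]),
    because that is also the coefficient obtained by differentiating x^alpha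
    n times ([derive1n_powR]).

    The value of the limit comes from n uses of Gamma(x + 1) = x Gamma(x)
    ([GammaD1]), which are legitimate at non-integer z; taking the limit on a
    punctured neighbourhood of alpha leaves only such z, and the falling
    factorial is continuous in z.  Dividing by Gamma requires that it does not
    vanish ([Gamma_neq0]).

    On the half-line x > 0 these two properties of Gamma are statements on
    Euler's integral.  The recurrence is an integration by parts on compact
    intervals that exhaust ]0, +oo[, with boundary terms that tend to 0
    ([euler_integralD1]).  It holds in the extended reals before the
    convergence of the integral is known, and convergence then follows from
    it ([euler_integral_fin_num]). *)

(** * Euler's integral *)

Definition euler_integrand (R : realType) (x t : R) : R :=
  t `^ (x - 1) * expR (- t).

(** The integral is kept in the extended reals: its real-valued version, which
    is [euler_gamma], is 0 when the integral diverges, so that identities for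
    it would have to wait until convergence is established. *)
Definition euler_integral (R : realType) (x : R) : \bar R :=
  (\int[lebesgue_measure]_(t in `]0%R, +oo[) (euler_integrand R x t)%:E)%E.

Lemma continuous_powR (R : realType) (p t : R) : 0 < t ->
  {for t, continuous (@powR R ^~ p)}.
Proof.
move=> t0; apply: differentiable_continuous; apply/derivable1_diffP.
by apply: derivable_powR; rewrite in_itv/= andbT.
Qed.

Lemma continuous_expRN (R : realType) : continuous (fun t : R => expR (- t)).
Proof.
by move=> t; apply: continuous_comp;
  [exact: opp_continuous|exact: continuous_expR].
Qed.

Lemma is_derive_NexpRN (R : realType) (t : R) :
  is_derive t 1 (fun t : R => - expR (- t)) (expR (- t)).
Proof.
by apply: is_derive_eq; rewrite -[RHS]opprK; congr (- _);
  rewrite /GRing.scale /= mulrN1.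
Qed.

Lemma continuous_euler_integrand (R : realType) (x t : R) : 0 < t ->
  {for t, continuous (euler_integrand R x)}.
Proof.
move=> t0; apply: cvgM; [exact: continuous_powR|exact: continuous_expRN].
Qed.

Lemma euler_integrand_ge0 (R : realType) (x t : R) : 0 <= euler_integrand R x t.
Proof. by rewrite mulr_ge0 ?powR_ge0 ?expR_ge0. Qed.

Lemma measurable_euler_integrand (R : realType) (x : R) (D : set R) :
  measurable_fun D (euler_integrand R x).
Proof.
apply: measurable_funTS; apply: measurable_funM; first exact: measurable_powR.
by apply: measurableT_comp => //; exact: measurable_funN.
Qed.

Lemma cvg_euler_boundary0 (R : realType) (x : R) : 0 < x ->
  t `^ x * expR (- t) @[t --> 0^'+] --> (0 : R).
Proof.
move=> x0; rewrite -[X in _ --> X](mul0r (expR (- 0))); apply: cvgM.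
  exact: powR_cvg0.
exact: cvg_at_right_filter (continuous_expRN R 0).
Qed.

(** With N > x, the bound t^N * t / (N + 1)! <= exp t makes the product at most
    (N + 1)! / t for t >= 1. *)
Lemma cvg_euler_boundaryy (R : realType) (x : R) :
  t `^ x * expR (- t) @[t --> +oo] --> (0 : R).
Proof.
pose N := (Num.truncn x).+1.
apply: (@squeeze_cvgr _ _ _ _ (cst 0) (fun t : R => N.+1`!%:R * t^-1)).
- near=> t; rewrite mulr_ge0 ?powR_ge0 ?expR_ge0//=.
  have t1 : 1 <= t by near: t; exact: nbhs_pinfty_ge.
  have t0 : 0 < t by rewrite (lt_le_trans ltr01).
  have e : t ^+ N.+1 / N.+1`!%:R <= expR t.
    by apply: le_trans (expR_ge1Dxn N (ltW t0)); rewrite ler_wpDl.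
  have p : t `^ x <= t ^+ N.
    by rewrite -powR_mulrn ?(ltW t0)// ler_powR// ltW// truncnS_gt.
  rewrite expRN ler_pdivrMr ?expR_gt0//.
  apply: (le_trans p); rewrite mulrAC ler_pdivlMr// -exprSr mulrC.
  by rewrite -ler_pdivrMr// ltr0n fact_gt0.
- exact: cvg_cst.
- rewrite -[X in _ --> X](mulr0 N.+1`!%:R); apply: cvgM.
    exact: cvg_cst.
  apply/(gtr0_cvgV0 (f := id)); last exact: cvg_id.
  exact: nbhs_pinfty_gt.
Unshelve. all: end_near. Qed.

Lemma integrable_euler_integrand (R : realType) (x a b : R) : 0 < a ->
  lebesgue_measure.-integrable `[a, b] (EFin \o euler_integrand R x).
Proof.
move=> a0; apply: continuous_compact_integrable; first exact: segment_compact.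
apply: continuous_in_subspaceT => t; rewrite inE/= in_itv/= => /andP[at_ _].
by apply: continuous_euler_integrand; rewrite (lt_le_trans a0).
Qed.

(** The interval stays away from 0 because t^(x - 1) is unbounded near 0 when
    x < 1. *)
Lemma euler_integral_by_parts (R : realType) (x a b : R) : 0 < a -> a < b ->
  (\int[lebesgue_measure]_(t in `[a, b]) (euler_integrand R (x + 1) t)%:E =
   (a `^ x * expR (- a) - b `^ x * expR (- b))%:E +
   x%:E * \int[lebesgue_measure]_(t in `[a, b]) (euler_integrand R x t)%:E)%E.
Proof.
move=> a0 ab.
have pos t : t \in `[a, b] -> 0 < t.
  by rewrite in_itv/= => /andP[+ _]; exact: lt_le_trans.
have cp (t : R) : 0 < t -> {for t, continuous (@powR R ^~ x)}.
  exact: continuous_powR.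
have cG (t : R) : {for t, continuous (fun t : R => - expR (- t))}.
  by apply: cvgN; exact: continuous_expRN.
have b0 : 0 < b := lt_trans a0 ab.
under eq_integral do rewrite /euler_integrand addrK.
rewrite (@integration_by_parts _ (@powR R ^~ x) (fun t => - expR (- t))
  (fun t => x * t `^ (x - 1)) (fun t => expR (- t)) a b)//.
- under eq_integral => t _ do
    rewrite mulrN -mulrA -mulNr EFinM -/(euler_integrand R x t).
  rewrite integralZl//; last exact: integrable_euler_integrand.
  rewrite EFinN mulNe oppeK; congr (_%:E + _)%E.
  by rewrite !mulrN opprK addrC.
- apply: continuous_in_subspaceT => t; rewrite inE => /pos t0.
  by apply: cvgM; [exact: cvg_cst|exact: continuous_powR].
- split.
  + move=> t tab; apply: derivable_powR; rewrite in_itv/= andbT.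
    by apply: pos; apply: subset_itv_oo_cc tab.
  + exact/cvg_at_right_filter/cp.
  + exact/cvg_at_left_filter/cp.
- move=> t tab; rewrite powR_derive1// in_itv/= andbT.
  by apply: pos; apply: subset_itv_oo_cc tab.
- apply: continuous_subspaceT; exact: continuous_expRN.
- split.
  + by move=> t _; case: (is_derive_NexpRN R t).
  + exact/cvg_at_right_filter/cG.
  + exact/cvg_at_left_filter/cG.
- by move=> t _; rewrite derive1E; case: (is_derive_NexpRN R t).
Qed.

(** Monotone convergence along the intervals [1/(n+2), n+2]; the shift by 2
    makes every one of them have distinct endpoints. *)
Lemma cvg_euler_integral (R : realType) (x : R) :
  (\int[lebesgue_measure]_(t in `[(n.+2%:R^-1)%R, n.+2%:R%R])
    (euler_integrand R x t)%:E
   @[n --> \oo] --> euler_integral R x)%E.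
Proof.
have -> : euler_integral R x = (\int[lebesgue_measure]_(t in
    \bigcup_n `[(n.+2%:R^-1 : R)%R, n.+2%:R%R]%classic)
    (euler_integrand R x t)%:E)%E.
  congr (integral _ _ _); apply/seteqP; split => t /=.
    rewrite in_itv/= andbT => t0.
    exists (maxn (Num.truncn t) (Num.truncn t^-1)) => //=.
    have ub (u : R) m : (Num.truncn u <= m)%N -> u <= m.+2%:R.
      move=> um; apply: ltW; apply: (lt_le_trans (truncnS_gt u)).
      by rewrite ler_nat ltnS (leq_trans um).
    rewrite in_itv/= ub ?leq_maxl// andbT.
    rewrite -[leRHS]invrK lef_pV2 ?posrE ?invr_gt0//.
    by rewrite ub// leq_maxr.
  by move=> [n _]/=; rewrite !in_itv/= andbT => /andP[+ _]; apply: lt_le_trans.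
apply: ge0_nondecreasing_set_cvg_integral => //.
- apply/nondecreasing_seqP => n; rewrite subsetEset; apply: subset_itv.
    by rewrite bnd_simp lef_pV2 ?posrE// ler_nat.
  by rewrite bnd_simp ler_nat.
- by move=> i; apply/measurable_EFinP; exact: measurable_euler_integrand.
- by move=> i t _; rewrite lee_fin euler_integrand_ge0.
Qed.

(** The integrands are nonnegative, so both integrals over ]0, +oo[ are limits
    of their truncations even if infinite; the boundary terms tend to 0, which
    leaves the recurrence. *)
Lemma euler_integralD1 (R : realType) (x : R) : 0 < x ->
  euler_integral R (x + 1) = (x%:E * euler_integral R x)%E.
Proof.
move=> x0.
suff lim : (\int[lebesgue_measure]_(t in `[(n.+2%:R^-1)%R, n.+2%:R%R])
    (euler_integrand R (x + 1) t)%:E @[n --> \oo] --> x%:E *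
    euler_integral R x)%E.
  exact: (cvg_unique _ (cvg_euler_integral R (x + 1)) lim).
have cy : (n.+2%:R : R) @[n --> \oo] --> +oo.
  have := @cvgr_idn R; rewrite -(cvg_shiftn 2); apply: cvg_trans.
  apply: near_eq_cvg.
  by apply: nearW => n; rewrite /= addn2.
have c0 : (n.+2%:R^-1 : R) @[n --> \oo] --> 0.
  by apply/gtr0_cvgV0 => //; exact: nearW.
have ab n : (n.+2%:R^-1 : R) < n.+2%:R.
  by rewrite (@lt_trans _ _ 1)// ?invf_lt1// ltr1n.
have a0 n : 0 < (n.+2%:R^-1 : R) by rewrite invr_gt0.
under eq_fun do rewrite (euler_integral_by_parts _ _ _ _ (a0 _) (ab _)).
rewrite -[(x%:E * _)%E]add0e; apply: cvgeD => //.
- apply/cvg_EFin; first by apply: nearW.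
  rewrite -(subr0 0); apply: cvgB.
  + by have /cvg_at_rightP := cvg_euler_boundary0 R x x0; apply.
  + exact: (cvg_comp _ _ cy (cvg_euler_boundaryy R x)).
- apply: cvgeZl => //. exact: cvg_euler_integral.
Qed.

Lemma euler_integral_ge0 (R : realType) (x : R) : (0 <= euler_integral R x)%E.
Proof. by apply: integral_ge0 => t _; rewrite lee_fin euler_integrand_ge0. Qed.

Lemma euler_integral1 (R : realType) : euler_integral R 1 = 1%E.
Proof.
rewrite /euler_integral; under eq_integral do
  rewrite /euler_integrand subrr powRr0 mul1r.
have mexp (D : set R) : measurable_fun D (fun t : R => expR (- t)).
  by apply: measurable_funTS; apply: measurableT_comp => //;
    exact: measurable_funN.
rewrite integral_itv_obnd_cbnd; last exact/measurable_EFinP.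
rewrite (@ge0_continuous_FTC2y _ _ (fun t => - expR (- t)) _ 0)//.
- by rewrite oppr0 expR0 EFinN oppeK add0e.
- apply: continuous_subspaceT; exact: continuous_expRN.
- by rewrite -[X in _ --> X]oppr0; apply: cvgN; exact: cvgr_expR.
- apply: cvg_at_right_filter; apply: cvgN; exact: continuous_expRN.
- by move=> t _; rewrite derive1E; case: (is_derive_NexpRN R t).
Qed.

(** The recurrence replaces estimates near 0 and at infinity.  From the value
    at 1 it gives finiteness at positive integers; the comparison
    t^x <= 1 + t^(N + 1), where N is the integer part of x, gives finiteness at
    x + 1; and the recurrence read backwards brings this down to x, which deals
    with the singularity of the integrand at 0. *)
Lemma euler_integral_fin_num (R : realType) (x : R) : 0 < x ->
  euler_integral R x \is a fin_num.
Proof.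
have fin_nat n : euler_integral R n.+1%:R \is a fin_num.
  elim: n => [|n IHn]; first by rewrite euler_integral1.
  by rewrite -addn1 natrD euler_integralD1// fin_numM.
move=> x0; pose N := Num.truncn x.
have fin1 : euler_integral R (x + 1) \is a fin_num.
  rewrite ge0_fin_numE ?euler_integral_ge0//.
  apply: (@le_lt_trans _ _ (euler_integral R 1 +
    euler_integral R N.+2%:R)%E); last first.
    by rewrite lte_add_pinfty// -ge0_fin_numE ?euler_integral_ge0//
      (fin_nat 0%N).
  rewrite /euler_integral -ge0_integralD//=.
  - apply: ge0_le_integral => //.
    + by move=> t _; rewrite lee_fin euler_integrand_ge0.
    + by apply/measurable_EFinP; exact: measurable_euler_integrand.
    + by apply/measurable_EFinP/measurable_funD;
        exact: measurable_euler_integrand.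
    + move=> t; rewrite /= in_itv/= andbT => t0.
      rewrite -EFinD lee_fin /euler_integrand -mulrDl ler_wpM2r ?expR_ge0//.
      rewrite subrr powRr0 addrK -addn1 natrD addrK.
      have [t1|t1] := leP t 1.
        rewrite ler_wpDr ?powR_ge0// -(powRr0 t) ger_powR ?t0//= ltW//.
      by rewrite ler_wpDl// ler_powR ?ltW// truncnS_gt.
  - by move=> t _; rewrite lee_fin euler_integrand_ge0.
  - by apply/measurable_EFinP; exact: measurable_euler_integrand.
  - by move=> t _; rewrite lee_fin euler_integrand_ge0.
  - by apply/measurable_EFinP; exact: measurable_euler_integrand.
move: fin1; rewrite euler_integralD1//; have := euler_integral_ge0 R x.
by case: (euler_integral R x) => //; rewrite gt0_muley ?lte_fin.
Qed.

(** By the recurrence it is enough to treat x + 1, where the integrand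
    t^x exp(-t) is at least exp(-2) on [1, 2]. *)
Lemma euler_integral_gt0 (R : realType) (x : R) :
  0 < x -> (0 < euler_integral R x)%E.
Proof.
move=> x0; suff : (0 < euler_integral R (x + 1))%E.
  by rewrite euler_integralD1// pmule_rgt0.
apply: (@lt_le_trans _ _ (\int[lebesgue_measure]_(t in `[1%R, 2%R])
    (expR (- 2))%:E)%E).
  rewrite integral_cst//= lebesgue_measure_itv/= lte_fin ltr1n.
  rewrite -EFinB -EFinM lte_fin.
  by rewrite mulr_gt0 ?expR_gt0// subr_gt0 ltr1n.
apply: (@le_trans _ _ (\int[lebesgue_measure]_(t in `[1%R, 2%R])
    (euler_integrand R (x + 1) t)%:E)%E).
  apply: ge0_le_integral => //.
  - by apply/measurable_EFinP; exact: measurable_euler_integrand.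
  - move=> t /=; rewrite in_itv/= => /andP[t1 t2].
    rewrite lee_fin /euler_integrand addrK -[leLHS]mul1r ler_pM ?expR_ge0//.
      by rewrite -(powRr0 t) ler_powR// ltW.
    by rewrite ler_expR lerN2.
apply: ge0_subset_integral => //.
- by apply/measurable_EFinP; exact: measurable_euler_integrand.
- by move=> t _; rewrite lee_fin euler_integrand_ge0.
- by apply: subset_itv; rewrite bnd_simp.
Qed.

Lemma euler_gammaD1 (R : realType) (x : R) : 0 < x ->
  euler_gamma (x + 1) = x * euler_gamma x.
Proof.
move=> x0; rewrite /euler_gamma /Rintegral.
rewrite -/(euler_integral R (x + 1)) -/(euler_integral R x).
by rewrite euler_integralD1// fineM// euler_integral_fin_num.
Qed.

Lemma euler_gamma_gt0 (R : realType) (x : R) : 0 < x -> 0 < euler_gamma x.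
Proof.
move=> x0; rewrite /euler_gamma /Rintegral -/(euler_integral R x).
rewrite fine_gt0// euler_integral_gt0//= -ge0_fin_numE ?euler_integral_ge0//.
exact: euler_integral_fin_num.
Qed.

(** * The Gamma function outside its poles *)

Lemma gamma_shift_gt0 (R : realType) (x : R) : 0 < x + (gamma_shift x)%:R.
Proof.
rewrite /gamma_shift; case: (ltrP 0 x) => [|x0]; first by rewrite mulr0n addr0.
by rewrite -ltrBlDl sub0r truncnS_gt.
Qed.

Lemma gamma_poleN_neq0 (R : realType) (x : R) (i : nat) :
  ~~ gamma_pole x -> x + i%:R != 0.
Proof.
apply: contra; rewrite addr_eq0 => /eqP->.
by rewrite /gamma_pole rpredN rpred_nat oppr_le0 ler0n.
Qed.

Lemma Gamma_neq0 (R : realType) (x : R) : ~~ gamma_pole x -> Gamma x != 0.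
Proof.
move=> xp; rewrite /Gamma mulf_neq0 ?invr_eq0//.
  by rewrite gt_eqF// euler_gamma_gt0// gamma_shift_gt0.
by apply/prodf_neq0 => i _; exact: gamma_poleN_neq0.
Qed.

Lemma gamma_shift_succ (R : realType) (x : R) : x <= 0 ->
  gamma_shift x = (gamma_shift (x + 1)).+1.
Proof.
move=> x0; rewrite /gamma_shift ltNge x0/=; congr _.+1.
case: (ltrP 0 (x + 1)) => x1.
  by apply/eqP; rewrite truncn_eq ?oppr_ge0//; lra.
have -> : - x = 1%:R - (x + 1) by ring.
by rewrite truncnD ?nnegrE ?oppr_ge0 ?rpred_nat// natrK.
Qed.

(** For x <= 0 this is a matter of definition: Gamma(x) and Gamma(x + 1) are
    computed from Euler's integral at the same point, and the product in the
    denominator has the extra factor x for Gamma(x).  Only x > 0 uses the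
    recurrence of the integral. *)
Lemma GammaD1 (R : realType) (x : R) : ~~ gamma_pole x ->
  Gamma (x + 1) = x * Gamma x.
Proof.
move=> xp; have [x0|x0] := ltP 0 x.
  rewrite /Gamma /gamma_shift x0 (addr_gt0 x0 ltr01) !big_ord0 !addr0 !divr1.
  exact: euler_gammaD1.
rewrite /Gamma (gamma_shift_succ _ x x0) big_ord_recl/=.
have xn0 : x != 0 by have := gamma_poleN_neq0 _ x 0 xp; rewrite addr0.
have -> : x + (gamma_shift (x + 1)).+1%:R = x + 1 + (gamma_shift (x + 1))%:R.
  by rewrite -addn1 natrD; ring.
under [in RHS]eq_bigr => i _ do rewrite /bump leq0n natrD addrA.
by rewrite addr0 invfM mulrCA mulVKf.
Qed.

(** * The ratio of Gamma values at an integer order *)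

Lemma Gamma_quotient_falling (R : realType) (n : nat) (z : R) :
  z \isn't a Num.int ->
  Gamma (z + 1) / Gamma (z - n%:R + 1) = \prod_(i < n) (z - i%:R).
Proof.
move=> zint; have pN (k : nat) : ~~ gamma_pole (z - k%:R).
  by rewrite /gamma_pole rpredBr ?rpred_nat// (negbTE zint).
elim: n => [|n IHn].
  rewrite big_ord0 subr0 divff// Gamma_neq0//.
  by rewrite /gamma_pole rpredDr ?rpred1// (negbTE zint).
rewrite big_ord_recr/= -IHn (GammaD1 _ _ (pN n)).
have -> : z - n.+1%:R + 1 = z - n%:R by rewrite -addn1 natrD; ring.
have zn : z - n%:R != 0.
  by have := gamma_poleN_neq0 _ _ 0 (pN n); rewrite addr0.
rewrite [((z - _) * _)^-1]invfM -mulrA; congr (_ * _).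
by rewrite [RHS]mulrC mulVKf.
Qed.

(** The open interval from ceil(alpha) - 1 to floor(alpha) + 1 contains no
    integer except possibly alpha itself. *)
Lemma near_dnbhs_nint (R : realType) (alpha : R) :
  \forall z \near alpha^', z \isn't a Num.int.
Proof.
have lo := ceilB1_lt alpha; have hi := floorD1_gt alpha.
near=> z; apply/negP => /intrP[m zm].
have za : z != alpha by near: z; exact: nbhs_dnbhs_neq.
have z1 : (Num.ceil alpha - 1)%:~R < z.
  by near: z; apply: nbhs_dnbhs; exact: lt_nbhsr.
have z2 : z < (Num.floor alpha + 1)%:~R.
  by near: z; apply: nbhs_dnbhs; exact: lt_nbhsl.
move: z1 z2 za; rewrite zm !ltr_int ltzD1 ltrBlDr ltzD1.
rewrite ceil_le_int floor_ge_int => z1 z2.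
by rewrite eq_le z1 z2.
Unshelve. all: end_near. Qed.

Lemma is_gamma_ratio_nat (R : realType) (n : nat) (alpha L : R) :
  is_gamma_ratio n%:R alpha L <-> L = \prod_(i < n) (alpha - i%:R).
Proof.
have lim : is_gamma_ratio n%:R alpha (\prod_(i < n) (alpha - i%:R)).
  rewrite /is_gamma_ratio.
  apply: (@cvg_trans _ (\prod_(i < n) (z - i%:R) @[z --> alpha^'])).
    apply: near_eq_cvg; near=> z.
    have zint : z \isn't a Num.int by near: z; exact: near_dnbhs_nint.
    rewrite -(Gamma_quotient_falling _ n _ zint) ratr_nat /inv_Gamma ifF//.
    apply/negP => /andP[+ _]; apply/negP; apply: contra zint => zn.
    have -> : z = (z - n%:R + 1) + n%:R - 1 by ring.
    by apply: rpredB (rpredD zn (rpred_nat _ _)) (rpred1 _).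
  apply: cvg_within_filter.
  elim: n => [|n IHn].
    by under eq_fun do rewrite big_ord0; rewrite big_ord0; exact: cvg_cst.
  under eq_fun do rewrite big_ord_recr/=; rewrite big_ord_recr/=.
  by apply: cvgM => //; apply: cvgB; [exact: cvg_id|exact: cvg_cst].
split=> [|->//].
by move=> /(cvg_unique (@Rhausdorff R)); apply.
Unshelve. all: end_near. Qed.

(** * The complementary sum and the power rule *)

Lemma complementary_sum_nat (R : realType) (n : nat) (c : int -> R) (x : R) :
  complementary_sum n%:R c x = 0.
Proof.
rewrite /complementary_sum /entire_part ler0n.
have -> : Num.floor (n%:R : rat) = n%:Z by exact: (@intrKfloor rat n%:Z).
apply: big1_seq => j /andP[_]; rewrite mem_index_iota => /andP[j0 _].
rewrite /inv_Gamma /gamma_pole intr_int/=.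
by case: ifP => [|/negbT]; rewrite ?mulr0// lerz0; lia.
Qed.

Lemma derive1n_powR (R : realType) (a alpha : R) (k : nat) (x : R) : 0 < x ->
  ((fun x : R => a * x `^ alpha)^`(k))%classic x
    = a * \prod_(i < k) (alpha - i%:R) * x `^ (alpha - k%:R).
Proof.
elim: k x => [|k IHk] x x0; first by rewrite derive1n0 big_ord0 mulr1 subr0.
rewrite derive1nS derive1E.
pose c : R := a * \prod_(i < k) (alpha - i%:R).
rewrite (@near_eq_derive _ _ _ _ (c \*: (@powR R ^~ (alpha - k%:R))));
  last first.
  by near=> y; apply: IHk; near: y; exact: lt_nbhsr.
rewrite deriveZ/=; last by apply: derivable_powR; rewrite in_itv/= andbT.
rewrite -derive1E powR_derive1 ?in_itv ?andbT// big_ord_recr/= -addn1 natrD.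
rewrite opprD addrA (mulrA a); exact: mulrA.
Unshelve. all: end_near. Qed.

Lemma derivable_derive1n_powR (R : realType) (a alpha : R) (k : nat) (x : R) :
  0 < x -> derivable ((fun x : R => a * x `^ alpha)^`(k))%classic x 1.
Proof.
move=> x0; set c := a * \prod_(i < k) (alpha - i%:R).
apply: (@near_eq_derivable _ _ _ (c \*: (@powR R ^~ (alpha - k%:R)))).
  by near=> y; apply/esym/derive1n_powR; near: y; exact: lt_nbhsr.
by apply: derivableZ; apply: derivable_powR; rewrite in_itv/= andbT.
Unshelve. all: end_near. Qed.

(** * Integer orders give ordinary derivatives *)

Theorem theorem4p1 (R : realType) (n : nat) (a alpha : R) :
  let f : R -> R := fun x => a * x `^ alpha in
  (forall (k : nat) (x : R), (k < n)%N -> 0 < x -> derivable (f^`(k))%classic x 1) /\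
  (forall g : R -> R,
     is_rat_derivative (n%:R) a alpha g <->
     (forall x : R, 0 < x -> g x = (f^`(n))%classic x)).
Proof.
move=> f; split=> [k x _ x0|g]; first exact: derivable_derive1n_powR.
split=> [[_ [L [c [/is_gamma_ratio_nat -> gE]]]] x x0|gE].
  by rewrite gE// complementary_sum_nat addr0 ratr_nat derive1n_powR.
split=> [[n1 _]|]; first by have := ler0n rat n; rewrite n1 oppr_ge0 ler10.
exists (\prod_(i < n) (alpha - i%:R)), (fun=> 0).
split=> [|x x0]; first exact/is_gamma_ratio_nat.
by rewrite gE// complementary_sum_nat addr0 ratr_nat derive1n_powR.
Qed.
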